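(* Let $E$ be a graph, $X\subseteq{\rm Reg}(E)$, $Y={\rm Reg}(E)\setminus X$, let $(\mathfrak X,\{R_e\}_{e\in E^1},\{D_v\}_{v\in E^0},\{f_e\}_{e\in E^1})$ be an $E$-relative branching system, and let $\pi:C_K^X(E)\to{\rm Hom}_K(M)$ be the induced representation. Then $\pi$ is injective if and only if all of the following hold: (1) $R_e\ne\emptyset$ and $D_v\ne\emptyset$ for every $e\in E^1$, $v\in E^0$; (2) $D_v\neq\bigcup_{e\in s^{-1}(v)}R_e$ for every $v\in Y$; (3) for every cycle without exits $c=e_1\cdots e_n$ based at a vertex $w$ with $s(e_i)\notin Y$ for all $i$, and every $m\in\mathbb N$, there exists $z_0\in D_w$ with $f_c^{\,j}(z_0)\ne z_0$ for all $j\in\{1,\dots,m\}$, where $f_c=f_{e_1}\circ\cdots\circ f_{e_n}:D_w\to D_w$.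
   Context: Let $K$ be a field and $E=(E^0,E^1,r,s)$ a directed graph (no countability or finiteness assumptions). A vertex $v$ is regular if $s^{-1}(v)$ is finite and nonempty; ${\rm Reg}(E)$ is the set of regular vertices. The relative Cohn path algebra $C_K^X(E)$ is the free $K$-algebra generated by $E^0\cup E^1\cup\{e^*:e\in E^1\}$ subject to: $vw=\delta_{v,w}v$; $s(e)e=er(e)=e$ and $r(e)e^*=e^*s(e)=e^*$; $e^*f=\delta_{e,f}r(e)$; $v=\sum_{e\in s^{-1}(v)}ee^*$ for $v\in X$. A cycle is a path $e_1\cdots e_n$ ($n\ge1$, $r(e_i)=s(e_{i+1})$) with $r(e_n)=s(e_1)$ and $s(e_i)\ne s(e_j)$ for $i\ne j$, based at $s(e_1)$; an exit is an edge $e$ with $s(e)=s(e_i)$ for some $i$ and $e\neq e_i$. An $E$-relative (algebraic) branching system consists of a set $\mathfrak X$ with subsets $\{R_e\}_{e\in E^1}$, $\{D_v\}_{v\in E^0}$ and maps $f_e$ such that: (1') $R_e\cap R_d=\emptyset$ for $d\ne e$; (2') $D_u\cap D_v=\emptyset$ for $u\ne v$; (3') $R_e\subseteq D_{s(e)}$; (4') $D_v=\bigcup_{s(e)=v}R_e$ for each $v\in X$; (5') each $f_e:D_{r(e)}\to R_e$ is a bijection. With $M$ the $K$-module of all functions $\mathfrak X\to K$, the induced representation is the $K$-algebra homomorphism $\pi:C_K^X(E)\to{\rm Hom}_K(M)$ with $\pi(v)\phi=\chi_{D_v}\phi$, $\pi(e)\phi=\chi_{R_e}\cdot(\phi\circ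 f_e^{-1})$, $\pi(e^* )\phi=\chi_{D_{r(e)}}\cdot(\phi\circ f_e)$ (functions being $0$ outside the indicated sets; $\chi_S$ is the characteristic function of $S$). *)

(* Defs.v *)
From HB Require Import structures.
From mathcomp Require Import all_boot all_algebra.
From Stdlib Require Import Classical ClassicalEpsilon.
From Stdlib Require List.
Set Implicit Arguments. Unset Strict Implicit. Unset Printing Implicit Defensive.
Import GRing.Theory.
Local Open Scope ring_scope.

Definition regular (V Ed : Type) (s : Ed -> V) (v : V) : Prop :=
  exists l : list Ed, List.NoDup l /\ l <> nil /\
    (forall e, List.In e l <-> s e = v).

(** Generators of the free algebra: vertices, edges, ghost edges e^*. *)
Inductive gen (V Ed : Type) : Type :=
  | GV : V -> gen V Ed
  | GE : Ed -> gen V Ed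
  | GS : Ed -> gen V Ed.

Inductive term (K : fieldType) (V Ed : Type) : Type :=
  | tgen : gen V Ed -> term K V Ed
  | tzero : term K V Ed
  | tadd : term K V Ed -> term K V Ed -> term K V Ed
  | tscal : K -> term K V Ed -> term K V Ed
  | tmul : term K V Ed -> term K V Ed -> term K V Ed.

Arguments tgen {K V Ed}.
Arguments tzero {K V Ed}.

Definition tsum (K : fieldType) (V Ed : Type) (l : list (term K V Ed)) :
  term K V Ed := foldr (@tadd K V Ed) tzero l.

Section Cohn.
Variables (K : fieldType) (V Ed : Type) (s r : Ed -> V) (X : V -> Prop).

Local Notation T := (term K V Ed).
Local Notation tv v := (@tgen K V Ed (GV Ed v)).
Local Notation te e := (@tgen K V Ed (@GE V Ed e)).
Local Notation ts e := (@tgen K V Ed (@GS V Ed e)).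

(** [ceq t1 t2] : t1 and t2 are equal in the relative Cohn path algebra
    C_K^X(E), i.e. the congruence generated by the axioms of (non-unital,
    associative) K-algebras and the defining relations.  C_K^X(E) is the
    quotient of [term] by [ceq]. *)
Inductive ceq : T -> T -> Prop :=
  | ceq_refl t : ceq t t
  | ceq_sym t u : ceq t u -> ceq u t
  | ceq_trans t u w : ceq t u -> ceq u w -> ceq t w
  | ceq_add t t' u u' : ceq t t' -> ceq u u' -> ceq (tadd t u) (tadd t' u')
  | ceq_mul t t' u u' : ceq t t' -> ceq u u' -> ceq (tmul t u) (tmul t' u')
  | ceq_scal k t t' : ceq t t' -> ceq (tscal k t) (tscal k t')
  | ceq_addA t u w : ceq (tadd t (tadd u w)) (tadd (tadd t u) w)
  | ceq_addC t u : ceq (tadd t u) (tadd u t)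
  | ceq_add0 t : ceq (tadd t tzero) t
  | ceq_addN t : ceq (tadd t (tscal (-1) t)) tzero
  | ceq_scal1 t : ceq (tscal 1 t) t
  | ceq_scalA a b t : ceq (tscal a (tscal b t)) (tscal (a * b) t)
  | ceq_scalDr a t u : ceq (tscal a (tadd t u)) (tadd (tscal a t) (tscal a u))
  | ceq_scalDl a b t : ceq (tscal (a + b) t) (tadd (tscal a t) (tscal b t))
  | ceq_mulA t u w : ceq (tmul t (tmul u w)) (tmul (tmul t u) w)
  | ceq_mulDl t u w : ceq (tmul (tadd t u) w) (tadd (tmul t w) (tmul u w))
  | ceq_mulDr t u w : ceq (tmul t (tadd u w)) (tadd (tmul t u) (tmul t w))
  | ceq_scal_mull a t u : ceq (tscal a (tmul t u)) (tmul (tscal a t) u)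
  | ceq_scal_mulr a t u : ceq (tscal a (tmul t u)) (tmul t (tscal a u))
  | ceq_vv v : ceq (tmul (tv v) (tv v)) (tv v)
  | ceq_vw v w : v <> w -> ceq (tmul (tv v) (tv w)) tzero
  | ceq_se e : ceq (tmul (tv (s e)) (te e)) (te e)
  | ceq_er e : ceq (tmul (te e) (tv (r e))) (te e)
  | ceq_rs e : ceq (tmul (tv (r e)) (ts e)) (ts e)
  | ceq_ss e : ceq (tmul (ts e) (tv (s e))) (ts e)
  | ceq_ee e : ceq (tmul (ts e) (te e)) (tv (r e))
  | ceq_ef e d : e <> d -> ceq (tmul (ts e) (te d)) tzero
  | ceq_CK v (l : list Ed) : X v -> List.NoDup l ->
      (forall e, List.In e l <-> s e = v) ->
      ceq (tv v) (tsum [seq tmul (te e) (ts e) | e <- l]).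

End Cohn.

Section Branching.
Variables (K : fieldType) (V Ed : Type) (s r : Ed -> V) (X : V -> Prop).
Variables (Xs : Type) (R : Ed -> Xs -> Prop) (D : V -> Xs -> Prop)
          (f : Ed -> Xs -> Xs).

Definition branching_system : Prop :=
  [/\ (forall d e, d <> e -> forall x, ~ (R d x /\ R e x)),
      (forall u v, u <> v -> forall x, ~ (D u x /\ D v x)),
      (forall e x, R e x -> D (s e) x),
      (forall v, X v -> forall x, D v x <-> exists e, s e = v /\ R e x) &
      (forall e,
          (forall x, D (r e) x -> R e (f e x)) /\
          (forall x y, D (r e) x -> D (r e) y -> f e x = f e y -> x = y) /\
          (forall y, R e y -> exists x, D (r e) x /\ f e x = y))].

(** M = all functions Xs -> K; operators are maps M -> M. *)
Definition chi (S : Xs -> Prop) (phi : Xs -> K) : Xs -> K :=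
  fun x => if excluded_middle_informative (S x) then phi x else 0.

Definition finv (e : Ed) (y : Xs) : option Xs :=
  match excluded_middle_informative (exists x, D (r e) x /\ f e x = y) with
  | left H => Some (proj1_sig (constructive_indefinite_description _ H))
  | right _ => None
  end.

Definition pi_gen (g : gen V Ed) (phi : Xs -> K) : Xs -> K :=
  match g with
  | GV v => chi (D v) phi
  | GE e => chi (R e) (fun y => match finv e y with
                                | Some x => phi x
                                | None => 0 end)
  | GS e => chi (D (r e)) (fun x => phi (f e x))
  end.

Fixpoint pi (t : term K V Ed) (phi : Xs -> K) : Xs -> K :=
  match t with
  | tgen g => pi_gen g phi
  | tzero => fun _ => 0
  | tadd a b => fun x => pi a phi x + pi b phi x
  | tscal k a => fun x => k * pi a phi x
  | tmul a b => pi a (pi b phi)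
  end.

(** pi : C_K^X(E) -> Hom_K(M) is injective: elements of C_K^X(E) (classes
    of terms modulo [ceq]) with the same image are equal. *)
Definition pi_injective : Prop :=
  forall t u : term K V Ed,
    (forall phi x, pi t phi x = pi u phi x) -> ceq s r X t u.

Definition fc_map (c : list Ed) : Xs -> Xs := foldr (fun e g => f e \o g) id c.

End Branching.

Definition is_cycle (V Ed : Type) (s r : Ed -> V) (c : list Ed) : Prop :=
  exists e1 rest, c = e1 :: rest /\
    (forall i, (i.+1 < size c)%N -> r (nth e1 c i) = s (nth e1 c i.+1)) /\
    r (last e1 rest) = s e1 /\
    (forall i j, (i < size c)%N -> (j < size c)%N ->
                 s (nth e1 c i) = s (nth e1 c j) -> i = j).

Definition no_exit (V Ed : Type) (s : Ed -> V) (c : list Ed) : Prop :=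
  forall e d, List.In d c -> s e = s d -> e = d.

(* Main.v *)
Require Import Defs.
From mathcomp Require Import all_boot all_algebra.
From Stdlib Require Import Classical ClassicalEpsilon FunctionalExtensionality.
From Stdlib Require Import Setoid Morphisms.
From Stdlib Require List.

(** Sufficiency: an element [t] with [t v = t] is a combination of products
    $\alpha\beta^*$ with $\beta$ starting at [v], and [t] lies in the kernel only
    if every [t e] does; by induction on the length of the $\beta$'s, [t e = 0] for
    all edges [e]. If [v] is in [X] this forces [t = 0]; otherwise
    $t = a v - \sum_{e \in F} a e e^*$ with [a] a combination of real paths and [F]
    finite. Applying [t] to the point mass at a point of $D_v$ outside the
    $R_e$, [e] in [F], which is moved to distinct points by distinct paths of
    [a], gives [a = 0]. Such a point exists: if all points of $D_v$ had bounded
    period under the closed paths at [v], any two paths from [v], one of them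
    closed, would be comparable, so the shortest closed path would be a cycle
    without exits whose points are all periodic, against (3).

    Necessity: the failure of a condition makes [pi] identify a vertex with 0,
    with $\sum e e^*$, or with a power of a cycle. These are distinct in the
    algebra because they act differently on the space of maximal paths
    equipped with an integer length counter. *)

Set Implicit Arguments. Unset Strict Implicit. Unset Printing Implicit Defensive.
Import GRing.Theory.
Local Open Scope ring_scope.

(** * Paths *)

Section Paths.
Variables (V Ed : Type) (s r : Ed -> V).

Definition start (p : list Ed) (v : V) : V := if p is e :: _ then s e else v.

Fixpoint path_to (p : list Ed) (v : V) : Prop :=
  if p is e :: q then r e = start q v /\ path_to q v else True.

Definition closed_path (v : V) (p : list Ed) : Prop :=
  [/\ path_to p v, start p v = v & p <> [::]].

Definition power (n : nat) (p : list Ed) : list Ed := flatten (nseq n p).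

Lemma start_cat p q v : start (p ++ q) v = start p (start q v).
Proof. by case: p. Qed.

Lemma path_to_cat p q v :
  path_to (p ++ q) v <-> path_to p (start q v) /\ path_to q v.
Proof.
by elim: p => [|e p IHp] /=; [tauto | rewrite IHp start_cat; tauto].
Qed.

Lemma path_to_inj p v w : p <> [::] -> path_to p v -> path_to p w -> v = w.
Proof.
elim: p => [//|e [|d p] IHp] _ /= [Hv Pv] [Hw Pw]; first by rewrite -Hv.
exact: IHp.
Qed.

Lemma path_to_last e p v : path_to (e :: p) v -> r (last e p) = v.
Proof. by elim: p e => [|d p IHp] e /= [H1 H2] //; apply: IHp. Qed.

Lemma path_to_nth e0 p v i : path_to p v -> (i.+1 < size p)%N ->
  r (nth e0 p i) = s (nth e0 p i.+1).
Proof.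
elim: p i => [//|e p IHp] [|i] /= [H1 H2] Hi; last exact: IHp.
by case: p H1 Hi {IHp H2}.
Qed.

Lemma is_cycle_path e1 rest : is_cycle s r (e1 :: rest) ->
  closed_path (s e1) (e1 :: rest).
Proof.
case=> e [q [[-> ->]]] [Hn [Hl _]]; split=> // {e1 rest}.
(* The first edge [d] varies in the induction while the closing vertex [s e] stays fixed. *)
suff H p : forall d, (forall i, (i.+1 < size (d :: p))%N ->
    r (nth e (d :: p) i) = s (nth e (d :: p) i.+1)) ->
    r (last d p) = s e -> path_to (d :: p) (s e) by exact: H.
elim: p => [|d' p IHp] d Hd Hlast; first by split.
by split; [exact: (Hd 0%N) | apply: IHp => // i Hi; apply: (Hd i.+1)].
Qed.

Lemma start_drop e0 p v i : (i < size p)%N ->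
  start (drop i p) v = s (nth e0 p i).
Proof. by move=> Hi; rewrite (drop_nth e0). Qed.

Lemma size_power n p : size (power n p) = (n * size p)%N.
Proof. by rewrite size_flatten /shape map_nseq sumn_nseq mulnC. Qed.

Lemma power_path v p n : path_to p v -> start p v = v ->
  path_to (power n p) v /\ start (power n p) v = v.
Proof.
move=> Hp Hs; elim: n => [|n [IH1 IH2]] //=.
by rewrite /power /= -/(power n p) path_to_cat start_cat IH2.
Qed.

Lemma shortest_closed_path v p : closed_path v p ->
  exists c, closed_path v c /\
    forall q, closed_path v q -> (size c <= size q)%N.
Proof.
have [n] := ubnP (size p); elim: n p => // n IHn p Hn Hp.
case: (classic (exists q, closed_path v q /\ (size q < size p)%N)).
  by case=> q [Hq Hlt]; apply: (IHn q) => //; apply: leq_trans Hlt _.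
move=> Hno; exists p; split=> // q Hq; rewrite leqNgt; apply/negP=> Hlt.
by apply: Hno; exists q.
Qed.

(* Excising the edges between two visits to a vertex gives a shorter closed path. *)
Lemma shortest_closed_path_cycle v c : closed_path v c ->
  (forall q, closed_path v q -> (size c <= size q)%N) -> is_cycle s r c.
Proof.
case=> Hp Hs Hn Hmin; case: c Hp Hs Hn Hmin => // e c Hp Hs _ Hmin.
exists e, c; split=> //; split; first by move=> i; apply: path_to_nth Hp.
split; first by rewrite (path_to_last Hp) -Hs.
have main i j : (i < j)%N -> (j < size (e :: c))%N ->
    s (nth e (e :: c) i) = s (nth e (e :: c) j) -> False.
  set p := e :: c in Hp Hs Hmin * => Hij Hj Hsij.
  have Hi := ltn_trans Hij Hj.
  have Hd : start (drop i p) v = start (drop j p) v.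
    by rewrite !(start_drop e).
  have Pi : path_to (take i p ++ drop i p) v by rewrite cat_take_drop.
  have Pj : path_to (take j p ++ drop j p) v by rewrite cat_take_drop.
  have Hsz : size (take i p ++ drop j p) = (i + (size p - j))%N.
    by rewrite size_cat size_drop size_takel // ltnW.
  have : closed_path v (take i p ++ drop j p).
    split.
    - apply/path_to_cat; rewrite -Hd.
      by move/path_to_cat: Pi => [? _]; move/path_to_cat: Pj => [_ ?].
    - by rewrite start_cat -Hd -start_cat cat_take_drop.
    - move=> H0; move: Hsz; rewrite H0 => /esym/eqP.
      by rewrite addn_eq0 subn_eq0 leqNgt Hj andbF.
  move/Hmin; rewrite Hsz leqNgt => /negP; apply.
  by rewrite -[X in (_ < X)%N](subnKC (ltnW Hj)) ltn_add2r.
move=> i j Hi Hj Hsij; case: (ltngtP i j) => // H; first by case: (main i j).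
by case: (main j i).
Qed.

End Paths.

(** * Operators of a branching system *)

Section Operators.
Variables (K : fieldType) (V Ed : Type) (s r : Ed -> V) (X : V -> Prop).
Variables (Xs : Type) (R : Ed -> Xs -> Prop) (D : V -> Xs -> Prop)
          (f : Ed -> Xs -> Xs).
Hypothesis HB : branching_system s r X R D f.

Local Notation T := (term K V Ed).
Local Notation tv v := (@tgen K V Ed (GV Ed v)).
Local Notation te e := (@tgen K V Ed (@GE V Ed e)).
Local Notation ts e := (@tgen K V Ed (@GS V Ed e)).
Local Notation pi := (@Defs.pi K V Ed r Xs R D f).
Local Notation fc := (fc_map f).

Lemma R_disjoint d e x : R d x -> R e x -> d = e.
Proof.
by case: HB => H _ _ _ _ Hd He; apply: NNPP => /H/(_ x); apply.
Qed.

Lemma D_disjoint u v x : D u x -> D v x -> u = v.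
Proof.
by case: HB => _ H _ _ _ Hd He; apply: NNPP => /H/(_ x); apply.
Qed.

Lemma R_sub_D e x : R e x -> D (s e) x.
Proof. by case: HB => _ _ H _ _; apply: H. Qed.

Lemma f_in_R e x : D (r e) x -> R e (f e x).
Proof. by case: HB => _ _ _ _ /(_ e) [H _] Dx; exact: H. Qed.

Lemma f_inj e x y : D (r e) x -> D (r e) y -> f e x = f e y -> x = y.
Proof. by case: HB => _ _ _ _ /(_ e) [_ [H _]] Dx Dy; exact: H. Qed.

Lemma f_surj e y : R e y -> exists x, D (r e) x /\ y = f e x.
Proof.
by case: HB => _ _ _ _ /(_ e) [_ [_ H]] /H [x [? <-]]; exists x.
Qed.

Lemma chi_in (S : Xs -> Prop) (phi : Xs -> K) x : S x -> chi S phi x = phi x.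
Proof. by rewrite /chi; case: excluded_middle_informative. Qed.

Lemma chi_out (S : Xs -> Prop) (phi : Xs -> K) x : ~ S x -> chi S phi x = 0.
Proof. by rewrite /chi; case: excluded_middle_informative. Qed.

Lemma pi_V_in v phi x : D v x -> pi (tv v) phi x = phi x.
Proof. exact: chi_in. Qed.

Lemma pi_V_out v phi x : ~ D v x -> pi (tv v) phi x = 0.
Proof. exact: chi_out. Qed.

Lemma pi_S_in e phi x : D (r e) x -> pi (ts e) phi x = phi (f e x).
Proof. by move=> H; rewrite /= chi_in. Qed.

Lemma pi_E_in e phi x : D (r e) x -> pi (te e) phi (f e x) = phi x.
Proof.
move=> H; rewrite /= chi_in; last exact: f_in_R.
rewrite /Defs.finv; case: excluded_middle_informative => [H'|nH]; last first.
  by case: nH; exists x.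
case: constructive_indefinite_description => x' /= [Dx' Hx'].
by rewrite (f_inj Dx' H Hx').
Qed.

Lemma pi_E_out e phi x : ~ R e x -> pi (te e) phi x = 0.
Proof. exact: chi_out. Qed.

(** Products are interpreted as compositions, so the soundness of right distributivity amounts to
    additivity of the operators. *)
Lemma pi_add t (phi psi : Xs -> K) :
  pi t (fun x => phi x + psi x) = fun x => pi t phi x + pi t psi x.
Proof.
elim: t phi psi => [g||a IHa b IHb|k a IHa|a IHa b IHb] phi psi;
  apply: functional_extensionality => x /=.
- case: g => [v|e|e] /=; rewrite /chi; case: excluded_middle_informative => H;
    rewrite ?addr0 //.
  by case: Defs.finv; rewrite ?addr0.
- by rewrite addr0.
- by rewrite IHa IHb addrACA.
- by rewrite IHa mulrDr.
- by rewrite IHb IHa.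
Qed.

Lemma pi_scal t k (phi : Xs -> K) :
  pi t (fun x => k * phi x) = fun x => k * pi t phi x.
Proof.
elim: t phi => [g||a IHa b IHb|k' a IHa|a IHa b IHb] phi;
  apply: functional_extensionality => x /=.
- case: g => [v|e|e] /=; rewrite /chi; case: excluded_middle_informative => H;
    rewrite ?mulr0 //.
  by case: Defs.finv; rewrite ?mulr0.
- by rewrite mulr0.
- by rewrite IHa IHb mulrDr.
- by rewrite IHa mulrCA.
- by rewrite IHb IHa.
Qed.

Lemma pi_ee e phi x : R e x -> pi (tmul (te e) (ts e)) phi x = phi x.
Proof.
move=> /f_surj [y [Dy ->]].
by rewrite [LHS]pi_E_in //; apply: pi_S_in.
Qed.

Lemma pi_range_sum_out l phi x : (forall e, List.In e l -> ~ R e x) ->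
  pi (tsum [seq tmul (te e) (ts e) | e <- l]) phi x = 0.
Proof.
elim: l => [//|e l IHl] H /=.
rewrite IHl => [|d Hd]; last by apply: H; right.
by rewrite addr0; apply: pi_E_out; apply: H; left.
Qed.

Lemma pi_range_sum_in l e phi x : List.NoDup l -> List.In e l -> R e x ->
  pi (tsum [seq tmul (te e) (ts e) | e <- l]) phi x = phi x.
Proof.
move=> Hl He Rx; elim: Hl He => [//|d l' Hd _ IHl] /= [He|He].
  rewrite -[X in X + _ = _]/(pi (tmul (te d) (ts d)) phi x).
  rewrite {}He in Hd *; rewrite pi_ee // pi_range_sum_out ?addr0 // => d' Hd' Rd'.
  by apply: Hd; rewrite (R_disjoint Rx Rd').
rewrite IHl // [X in X + _]pi_E_out ?add0r // => Rd.
by apply: Hd; rewrite (R_disjoint Rd Rx).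
Qed.

(** This makes [pi] well defined on $C_K^X(E)$. It also separates elements of the algebra: terms
    acting differently on some branching system are not [ceq]. *)
Lemma pi_sound t u : ceq s r X t u -> pi t = pi u.
Proof.
elim=> {t u}; do ?[by move=> *; congruence].
- by move=> t t' u u' _ /= -> _ ->.
- by move=> t t' u u' _ /= -> _ ->.
- by move=> k t t' _ /= ->.
all: intros; apply: functional_extensionality => phi;
     try (apply: functional_extensionality => x).
- exact: addrA.
- exact: addrC.
- exact: addr0.
- by rewrite /= mulN1r subrr.
- exact: mul1r.
- exact: mulrA.
- exact: mulrDr.
- exact: mulrDl.
- by [].
- by [].
- by rewrite /= pi_add.
- by [].
- by rewrite /= pi_scal.
- case: (classic (D v x)) => H; last by rewrite /= !chi_out.
  by rewrite /= chi_in.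
- case: (classic (D v x)) => H'; last by rewrite /= !chi_out.
  rewrite /= chi_in // chi_out // => Hw; apply: H; exact: D_disjoint H' Hw.
- case: (classic (D (s e) x)) => H; first by rewrite /= chi_in.
  rewrite /= chi_out //; symmetry; apply: chi_out => /R_sub_D //.
- case: (classic (R e x)) => [/f_surj [y [Dy ->]]|H]; last first.
    by rewrite [LHS]pi_E_out // [RHS]pi_E_out.
  by rewrite [LHS]pi_E_in // [LHS]pi_V_in // [RHS]pi_E_in.
- case: (classic (D (r e) x)) => H; first by rewrite /= chi_in.
  by rewrite /= !chi_out.
- case: (classic (D (r e) x)) => H; last by rewrite /= !chi_out.
  rewrite [LHS]pi_S_in // [RHS]pi_S_in // [LHS]pi_V_in //; exact/R_sub_D/f_in_R.
- case: (classic (D (r e) x)) => H; last by rewrite /= !chi_out.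
  by rewrite [LHS]pi_S_in // [RHS]pi_V_in // [LHS]pi_E_in.
- case: (classic (D (r e) x)) => H'; last by rewrite /= !chi_out.
  rewrite [LHS]pi_S_in // [LHS]pi_E_out // => H2.
  by apply: H; apply: R_disjoint H2; apply: f_in_R.
(* The Cuntz-Krieger relation at [v] is axiom (4'): a point of $D_v$ lies in exactly one $R_e$ with
   [e] in [l], a point outside in none. *)
- case: HB => _ _ _ /(_ v H x) HD _.
  case: (classic (D v x)) => [Dx|Dx].
    have [e [He Re]] := HD.1 Dx.
    by rewrite pi_V_in // (pi_range_sum_in (e := e)) //; apply/H1.
  rewrite pi_V_out // pi_range_sum_out // => e He Re; apply: Dx; apply/HD.
  by exists e; split=> //; apply/H1.
Qed.

(** * Action of paths on points *)

Lemma fc_cat p q z : fc (p ++ q) z = fc p (fc q z).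
Proof. by elim: p => //= e p ->. Qed.

Lemma fc_power n p z : fc (power n p) z = iter n (fc p) z.
Proof. by elim: n => //= n IHn; rewrite /power /= fc_cat -/(power n p) IHn. Qed.

Lemma fc_power_fix n p z : fc p z = z -> fc (power n p) z = z.
Proof. by rewrite fc_power => H; elim: n => //= n ->. Qed.

Lemma fc_in_D p v z : path_to s r p v -> D v z -> D (start s p v) (fc p z).
Proof.
elim: p => [//|e p IHp] /= [He Hp] Dz.
by apply: R_sub_D; apply: f_in_R; rewrite He; apply: IHp.
Qed.

Lemma fc_in_R e p v z : path_to s r (e :: p) v -> D v z -> R e (fc (e :: p) z).
Proof. by move=> /= [He Hp] Dz; apply: f_in_R; rewrite He; apply: fc_in_D. Qed.

(** The $R_e$ are disjoint and the $f_e$ injective, so equal images force equal first edges, which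
    can be cancelled until one path runs out. *)
Lemma fc_compare p q v w x y : path_to s r p v -> path_to s r q w ->
  D v x -> D w y -> fc p x = fc q y ->
  (exists g, p = q ++ g /\ y = fc g x) \/ (exists g, q = p ++ g /\ x = fc g y).
Proof.
move=> Hp Hq Dx Dy; elim: p q Hp Hq => [|e p IHp] q Hp Hq Heq.
  by right; exists q.
case: q Hq Heq => [|d q] Hq Heq; first by left; exists (e :: p).
have Re := fc_in_R Hp Dx; have Rd := fc_in_R Hq Dy; rewrite Heq in Re.
have Ede := R_disjoint Re Rd; rewrite -{}Ede in Hq Heq *.
case: Hp Hq Heq {Re Rd} => [He Hp] [He' Hq] /= /f_inj.
case/(_ _ _)/IHp => // [| | [g [-> ->]]|[g [-> ->]]].
- by rewrite He; apply: fc_in_D.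
- by rewrite He'; apply: fc_in_D.
- by left; exists g.
- by right; exists g.
Qed.

(** The algebra has no unit, so the end vertex closes the product; the empty path becomes the vertex
    itself. *)
Definition path_term (v : V) (p : list Ed) : T :=
  foldr (fun e t => tmul (te e) t) (tv v) p.

Lemma pi_path_in p v phi x : path_to s r p v -> D v x ->
  pi (path_term v p) phi (fc p x) = phi x.
Proof.
move=> Hp Dx; elim: p Hp => [_|e p IHp /= [He Hp]]; first exact: pi_V_in.
by rewrite [LHS]pi_E_in ?IHp // He; apply: fc_in_D.
Qed.

Lemma pi_path_out p v phi y : path_to s r p v ->
  (forall x, D v x -> y <> fc p x) -> pi (path_term v p) phi y = 0.
Proof.
elim: p y => [|e p IHp] y Hp Hy; first by apply: pi_V_out => /Hy; apply.
case: (classic (R e y)) => [/f_surj [x [Dx Ey]]|Re]; last exact: pi_E_out.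
rewrite {}Ey in Hy *; rewrite [LHS]pi_E_in //; apply: IHp; first by case: Hp.
by move=> x' Dx' Hx; apply: (Hy x' Dx'); rewrite Hx.
Qed.

Definition delta (z : Xs) : Xs -> K :=
  fun x => if excluded_middle_informative (x = z) then 1 else 0.

Lemma delta_eq z : delta z z = 1.
Proof. by rewrite /delta; case: excluded_middle_informative. Qed.

Lemma delta_neq z x : x <> z -> delta z x = 0.
Proof. by rewrite /delta; case: excluded_middle_informative. Qed.

(** With [pi_path_in] this says that a path carries the point mass at [z] to the point mass at
    [fc p z]. *)
Lemma pi_path_delta_neq p v z y : path_to s r p v -> D v z ->
  y <> fc p z -> pi (path_term v p) (delta z) y = 0.
Proof.
move=> Hp Dz Hy; case: (classic (exists x, D v x /\ y = fc p x)).
  case=> x [Dx Ey]; rewrite Ey pi_path_in // delta_neq // => Exz.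
  by apply: Hy; rewrite Ey Exz.
by move=> H; apply: pi_path_out => // x Dx Ey; apply: H; exists x.
Qed.

End Operators.

(** * Points without short periods *)

Section Aperiodic.
Variables (V Ed : Type) (s r : Ed -> V) (X : V -> Prop).
Variables (Xs : Type) (R : Ed -> Xs -> Prop) (D : V -> Xs -> Prop)
          (f : Ed -> Xs -> Xs).
Hypothesis HB : branching_system s r X R D f.
Hypothesis D_nonempty : forall v, exists x, D v x.

Local Notation fc := (fc_map f).
Local Notation path := (path_to s r).
Local Notation start := (start s).
Local Notation closed := (closed_path s r).

(** * Consequences of every point of $D_v$ being fixed by a closed path of length at most [B] *)

Section AllPeriodic.
Variables (B : nat) (v : V).
Hypothesis short_period : forall z, D v z ->
  exists g, [/\ closed v g, (size g <= B)%N & fc g z = z].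

(** The point [fc p y] is fixed by a power of a closed path longer than [p]. That power must extend
    [p], and its next edge after [p] is the required [e]. *)
Lemma reachable_covered p w : path p w -> start p w = v ->
  forall y, D w y -> exists e, s e = w /\ R e y.
Proof.
move=> Hp Hs y Dy; have Dz := fc_in_D HB Hp Dy; rewrite Hs in Dz.
have [g [[Hg Hgs Hg0] _ Hfix]] := short_period Dz.
have [Hn Hns] := power_path (size p).+1 Hg Hgs.
have Hsz : (size p < size (power (size p).+1 g))%N.
  by rewrite size_power leq_pmulr // lt0n; case: (g) Hg0.
have := esym (fc_power_fix (size p).+1 Hfix).
case/(fc_compare HB Hp Hn Dy Dz) => [] [h [Hh Eh]].
  have := leq_addr (size h) (size (power (size p).+1 g)).
  by rewrite -size_cat -Hh leqNgt Hsz.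
case: h Hh Eh => [|e h] Hh Eh; first by move: Hsz; rewrite Hh cats0 ltnn.
move: Hn; rewrite Hh => /path_to_cat [_ Hh'].
have Re := fc_in_R HB Hh' Dz; rewrite -Eh in Re; exists e; split=> //.
exact: (D_disjoint HB (R_sub_D HB Re) Dy).
Qed.

(* A point whose itinerary starts with p^(B!) q has a period of length dividing
   B!, so its itinerary also starts with q as well as with p. *)
Lemma closed_path_comparable p q w : closed v p -> path q w -> start q w = v ->
  (exists g, p = q ++ g) \/ (exists g, q = p ++ g).
Proof.
move=> [Hp Hps Hp0] Hq Hqs; have [y Dy] := D_nonempty w.
have Dqy := fc_in_D HB Hq Dy; rewrite Hqs in Dqy.
have [HpN HpNs] := power_path B`! Hp Hps.
have Dz := fc_in_D HB HpN Dqy; rewrite HpNs in Dz.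
have [g [[Hg Hgs Hg0] HgB Hfix]] := short_period Dz.
have g_gt0 : (0 < size g)%N by case: (g) Hg0.
(* Since $|g| \le B$ divides $B!$, some power of [g] has exactly the length of $p^{B!}$; comparing
   the two leaves no remainder. *)
have [k Hk] : exists k, (k * size g = B`! * size p)%N.
  exists (B`! * size p %/ size g)%N; rewrite divnK // dvdn_mulr //.
  by apply: dvdn_fact; rewrite g_gt0.
have [HgN HgNs] := power_path k Hg Hgs.
have Ez : fc (power B`! p) (fc q y) = fc q y.
  have := esym (fc_power_fix k Hfix).
  have nil_of a b h : a = b ++ h -> size a = size b -> h = [::] :> list Ed.
    move=> ->; rewrite size_cat -{2}[size b]addn0 => /eqP.
    by rewrite eqn_add2l => /nilP.
  case/(fc_compare HB HpN HgN Dqy Dz) => [] [h [Hh Eh]].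
    by rewrite Eh (nil_of _ _ _ Hh) // !size_power Hk.
  by rewrite [RHS]Eh (nil_of _ _ _ Hh) // !size_power Hk.
(* As $B!$ is positive, one copy of [p] splits off, and the point [fc q y] lies in the image of both
   [p] and [q]. *)
have [n Hn] : exists n, B`! = n.+1 by case: B`! (fact_gt0 B) => // n; exists n.
rewrite Hn /power /= fc_cat -/(power n p) in Ez.
have [Hpn Hpns] := power_path n Hp Hps.
have Dn := fc_in_D HB Hpn Dqy; rewrite Hpns in Dn.
by case: (fc_compare HB Hp Hq Dn Dy Ez) => [] [h [Hh _]]; [left|right]; exists h.
Qed.

(** Replacing [d] by another edge [e] at the same vertex gives a path [c1 ++ [:: e]] from [v]. It is
    comparable with [c], so the edges after [c1] agree. *)
Lemma closed_path_no_exit c : closed v c -> no_exit s c.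
Proof.
move=> Hc e d /(List.in_split _ _) [c1 [c2 Ec0]] Hed.
have Ec : c = c1 ++ d :: c2 by exact: Ec0.
have [Hp Hs _] := Hc.
have Hq : path (c1 ++ [:: e]) (r e).
  apply/path_to_cat; split; last by split.
  by move: Hp; rewrite Ec => /path_to_cat [H _]; rewrite /= Hed.
have Hqs : start (c1 ++ [:: e]) (r e) = v.
  by rewrite start_cat /= Hed -[RHS]Hs Ec start_cat.
have Hcat (a b : list Ed) : c1 ++ e :: a = c1 ++ d :: b -> e = d.
  by elim: (c1) => [[->]//|x l IHl] /= [].
case: (closed_path_comparable Hc Hq Hqs) => [] [g Hg].
  by apply: (@Hcat g c2); move: Hg; rewrite Ec -catA => /esym.
by apply: (@Hcat [::] (c2 ++ g)); rewrite Hg Ec -catA.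
Qed.

(** By comparability and minimality, [c] is a prefix of every nonempty closed path at [v]; it is
    removed and the length decreases. *)
Lemma closed_path_power c : closed v c ->
  (forall q, closed v q -> (size c <= size q)%N) ->
  forall p, path p v -> start p v = v -> exists n, p = power n c.
Proof.
move=> Hc Hmin p; have [m] := ubnP (size p); elim: m p => // m IHm p Hm Hp Hps.
case: (classic (p = [::])) => [->|Hp0]; first by exists 0%N.
have Hcp : closed v p by split.
have [g Hg] : exists g, p = c ++ g.
  case: (closed_path_comparable Hc Hp Hps) => // -[g Hg].
  have := Hmin p Hcp; rewrite Hg size_cat -{2}[size p]addn0 leq_add2l leqn0.
  by move=> /nilP Eg; exists [::]; rewrite Eg !cats0.
have [Hcv _ Hc0] := Hc.
move: Hp; rewrite Hg => /path_to_cat [Hcg Hgv].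
have [n Hn] : exists n, g = power n c.
  apply: IHm => //; last by rewrite (path_to_inj Hc0 Hcg Hcv).
  move: Hm; rewrite Hg size_cat ltnS; apply: leq_trans.
  by rewrite -addn1 addnC leq_add2r lt0n; case: (c) Hc0.
by exists n.+1; rewrite Hn.
Qed.

End AllPeriodic.

Hypothesis not_covered : forall v, regular s v /\ ~ X v ->
  ~ (forall x, D v x <-> exists e, s e = v /\ R e x).
Hypothesis cycle_aperiodic : forall (c : list Ed) (e1 : Ed) (rest : list Ed),
  c = e1 :: rest -> is_cycle s r c -> no_exit s c ->
  (forall d, List.In d c -> ~ (regular s (s d) /\ ~ X (s d))) ->
  forall m : nat, exists z0, D (s e1) z0 /\
    (forall j : nat, (1 <= j <= m)%N -> iter j (fc c) z0 <> z0).

Lemma exists_aperiodic B v : exists z, D v z /\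
  forall g, closed v g -> (size g <= B)%N -> fc g z <> z.
Proof.
apply: NNPP => Hno.
have short z : D v z -> exists g, [/\ closed v g, (size g <= B)%N & fc g z = z].
  move=> Dz; apply: NNPP => Hz; apply: Hno; exists z; split=> // g Hg HgB Hfix.
  by apply: Hz; exists g.
have [x Dx] := D_nonempty v; have [g0 [Hg0 _ _]] := short x Dx.
have [c [Hc Hmin]] := shortest_closed_path Hg0.
have Hcyc := shortest_closed_path_cycle Hc Hmin.
have Hnex := closed_path_no_exit short Hc.
case Ec : c (Hc) => [|e rest] [Hp Hs Hc0] //.
(* Every vertex on [c] is reachable from [v], hence covered, so condition (2) keeps it out of
   $Y$. *)
have HY d : List.In d c -> ~ (regular s (s d) /\ ~ X (s d)).
  move=> /(List.in_split _ _) [c1 [c2 Ec0]] Y;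
  have Ec' : c = c1 ++ d :: c2 by exact: Ec0.
   apply: (not_covered Y) => y.
  split; last by case=> e' [<- Re']; exact: (R_sub_D HB Re').
  case: (Hc) => Hp' Hs' _; rewrite Ec' in Hp' Hs'.
  have [Hc1 _] := (path_to_cat _ _ _ _ _).1 Hp'.
  by apply: (reachable_covered short Hc1); rewrite -[RHS]Hs' start_cat.
(* Condition (3) with $m = B$ is violated: the closed path fixing [z] is $c^n$ with $1 \le n \le
   |c^n| \le B$. *)
have [z [Dz Hz]] := cycle_aperiodic Ec Hcyc Hnex HY B.
rewrite /= in Hs; rewrite Hs in Dz.
have [g [[Hg Hgs Hgn] HgB Hfix]] := short z Dz.
have [n Hn] := closed_path_power short Hc Hmin Hg Hgs.
apply: (Hz n); last by rewrite -fc_power -Hn.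
case: n Hn => [Hn|n Hn]; first by rewrite Hn in Hgn.
apply: leq_trans HgB; rewrite Hn size_power leq_pmulr //.
by rewrite lt0n Ec.
Qed.

End Aperiodic.

(** * The relative Cohn path algebra *)

Section Algebra.
Variables (K : fieldType) (V Ed : Type) (s r : Ed -> V) (X : V -> Prop).

Local Notation T := (term K V Ed).
Local Notation tv v := (@tgen K V Ed (GV Ed v)).
Local Notation te e := (@tgen K V Ed (@GE V Ed e)).
Local Notation ts e := (@tgen K V Ed (@GS V Ed e)).
Local Notation path := (path_to s r).
Local Notation start := (start s).
Local Notation path_term := (@path_term K V Ed).
Local Notation ceq := (@ceq K V Ed s r X).
Local Notation "t =~ u" := (ceq t u) (at level 70).

#[local] Instance ceq_equivalence : Equivalence ceq.
Proof.
by split; [exact: ceq_refl | exact: ceq_sym | exact: ceq_trans].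
Qed.

#[local] Instance tadd_proper : Proper (ceq ==> ceq ==> ceq) (@tadd K V Ed).
Proof. by move=> t t' H u u' H'; apply: ceq_add. Qed.

#[local] Instance tmul_proper : Proper (ceq ==> ceq ==> ceq) (@tmul K V Ed).
Proof. by move=> t t' H u u' H'; apply: ceq_mul. Qed.

#[local] Instance tscal_proper k : Proper (ceq ==> ceq) (@tscal K V Ed k).
Proof. by move=> t t' H; apply: ceq_scal. Qed.

#[local] Hint Resolve ceq_refl : core.

Lemma ceq_0add t : tadd tzero t =~ t.
Proof. by rewrite ceq_addC ceq_add0. Qed.

(** The absorption laws for zero are not among the axioms; they follow because an additive
    idempotent vanishes. *)
Lemma ceq_addI t : tadd t t =~ t -> t =~ tzero.
Proof.
by move=> H; rewrite -[X in X =~ _]ceq_add0 -(ceq_addN _ _ _ t) ceq_addA H.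
Qed.

Lemma ceq_0mul t : tmul tzero t =~ tzero.
Proof. by apply: ceq_addI; rewrite -ceq_mulDl ceq_add0. Qed.

Lemma ceq_mul0 t : tmul t tzero =~ tzero.
Proof. by apply: ceq_addI; rewrite -ceq_mulDr ceq_add0. Qed.

Lemma ceq_0scal t : tscal 0 t =~ tzero.
Proof. by apply: ceq_addI; rewrite -ceq_scalDl addr0. Qed.

Lemma ceq_scal0 k : tscal k tzero =~ tzero.
Proof. by apply: ceq_addI; rewrite -ceq_scalDr ceq_add0. Qed.

Lemma ceq_sub_eq0 t u : tadd t (tscal (-1) u) =~ tzero -> t =~ u.
Proof.
move=> H; rewrite -[X in _ =~ X]ceq_0add -H -ceq_addA.
by rewrite [tadd (tscal _ _) _]ceq_addC ceq_addN ceq_add0.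
Qed.

(** * Real paths and the normal form $\alpha\beta^*$ *)

Lemma path_term_mulr v p : tmul (path_term v p) (tv v) =~ path_term v p.
Proof.
by elim: p => [|e p IHp] /=; [exact: ceq_vv | rewrite -ceq_mulA IHp].
Qed.

Lemma path_term_mul_edge p e :
  tmul (path_term (s e) p) (te e) =~ path_term (r e) (p ++ [:: e]).
Proof.
by elim: p => [|d p IHp] /=; [rewrite ceq_se ceq_er | rewrite -ceq_mulA IHp].
Qed.

Lemma vertex_mul_path v p : path p v ->
  tmul (tv (start p v)) (path_term v p) =~ path_term v p.
Proof. by case: p => [|e p] _ /=; [exact: ceq_vv | rewrite ceq_mulA ceq_se]. Qed.

Lemma vertex_mul_path0 v p w : w <> start p v ->
  tmul (tv w) (path_term v p) =~ tzero.
Proof.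
case: p => [|e p] /= Hw; first exact: ceq_vw.
by rewrite -ceq_se !ceq_mulA ceq_vw // !ceq_0mul.
Qed.

(** [ghost_span N v] is spanned by the products $\alpha\beta^*$ with
    $|\beta| \le N$ and $\beta$ starting at [v]. *)
Inductive ghost_span : nat -> V -> T -> Prop :=
  | gs_ceq N v t u : t =~ u -> ghost_span N v t -> ghost_span N v u
  | gs_zero N v : ghost_span N v tzero
  | gs_add N v t u :
      ghost_span N v t -> ghost_span N v u -> ghost_span N v (tadd t u)
  | gs_scal N v k t : ghost_span N v t -> ghost_span N v (tscal k t)
  | gs_path N v p : path p v -> ghost_span N v (path_term v p)
  | gs_ghost N e t : ghost_span N (r e) t -> ghost_span N.+1 (s e) (tmul t (ts e)).

Lemma ghost_span_le N M v t : (N <= M)%N -> ghost_span N v t -> ghost_span M v t.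
Proof.
move=> Hle H; elim: H M Hle => {N v t}.
- by move=> N v t u E _ IH M HM; apply: gs_ceq E (IH _ HM).
- by move=> *; apply: gs_zero.
- by move=> N v t u _ IHt _ IHu M HM; apply: gs_add; [apply: IHt | apply: IHu].
- by move=> N v k t _ IH M HM; apply: gs_scal; apply: IH.
- by move=> N v p Hp M _; apply: gs_path.
- by move=> N e t _ IH [//|M] HM; apply: gs_ghost; apply: IH.
Qed.

Lemma ghost_span_mulr N v t : ghost_span N v t -> tmul t (tv v) =~ t.
Proof.
elim=> {N v t}.
- by move=> N v t u E _ IH; rewrite -E.
- by move=> *; apply: ceq_0mul.
- by move=> N v t u _ IHt _ IHu; rewrite ceq_mulDl IHt IHu.
- by move=> N v k t _ IH; rewrite -ceq_scal_mull IH.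
- by move=> *; apply: path_term_mulr.
- by move=> N e t _ _; rewrite -ceq_mulA ceq_ss.
Qed.

(** The rightmost factor of $\alpha\beta^*$ is the ghost of the first edge of $\beta$: [e] cancels
    it or kills the product. If $\beta$ is trivial, [e] prolongs $\alpha$. *)
Lemma ghost_span_mul_edge N e t :
  ghost_span N.+1 (s e) t -> ghost_span N (r e) (tmul t (te e)).
Proof.
move EM : N.+1 => M; move Ev : (s e) => v H.
elim: H N EM Ev => {M v t}.
- by move=> M v t u E _ IH N EM Ev; apply: gs_ceq (IH N EM Ev); rewrite E.
- by move=> M v N _ _; apply: gs_ceq (gs_zero _ _); rewrite ceq_0mul.
- move=> M v t u _ IHt _ IHu N EM Ev.
  apply: (gs_ceq (t := tadd (tmul t (te e)) (tmul u (te e)))).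
    by rewrite ceq_mulDl.
  by apply: gs_add; [apply: IHt | apply: IHu].
- move=> M v k t _ IH N EM Ev.
  apply: (gs_ceq (t := tscal k (tmul t (te e)))); first exact: ceq_scal_mull.
  by apply: gs_scal; apply: IH.
- move=> M v p Hp N _ Ev; rewrite -Ev.
  apply: gs_ceq; first by symmetry; apply: path_term_mul_edge.
  by apply: gs_path; apply/path_to_cat; rewrite /= Ev.
- move=> M d t Ht _ N [EM] Ev; rewrite -{}EM in Ht.
  case: (classic (d = e)) => [Ede|Hde].
    rewrite -{}Ede; apply: (gs_ceq (t := t)) => //.
    by rewrite -ceq_mulA ceq_ee (ghost_span_mulr Ht).
  apply: (gs_ceq (t := tzero)); last exact: gs_zero.
  by rewrite -ceq_mulA ceq_ef // ceq_mul0.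
Qed.

(** The generator meets the real path $\alpha$ first and lengthens, shortens, keeps or kills it. The
    bound grows because a ghost edge meeting a trivial $\alpha$ survives as one more ghost edge. *)
Lemma gen_mul_ghost_span g N v t :
  ghost_span N v t -> ghost_span N.+1 v (tmul (tgen g) t).
Proof.
elim=> {N v t}.
- by move=> N v t u E _; apply: gs_ceq; rewrite E.
- by move=> N v; apply: gs_ceq (gs_zero _ _); rewrite ceq_mul0.
- move=> N v t u _ IHt _ IHu; apply: gs_ceq (gs_add IHt IHu).
  by rewrite ceq_mulDr.
- by move=> N v k t _ IH; apply: gs_ceq (gs_scal k IH); exact: ceq_scal_mulr.
- move=> N v p Hp.
  have zero t : t =~ tzero -> ghost_span N.+1 v t.
    by move=> E; apply: gs_ceq (gs_zero _ _); rewrite E.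
  case: g => [w|e|e].
  + case: (classic (w = start p v)) => [->|Hw].
      by apply: gs_ceq (gs_path _ Hp); rewrite vertex_mul_path.
    by apply: zero; apply: vertex_mul_path0.
  + case: (classic (r e = start p v)) => [Hr|Hr].
      exact: (@gs_path N.+1 v (e :: p)).
    by apply: zero; rewrite -ceq_er -ceq_mulA vertex_mul_path0 // ceq_mul0.
  + case: p Hp => [|d p] /= => [_|[Hr Hp]].
      case: (classic (s e = v)) => [<-|He].
        apply: gs_ceq (gs_ghost (N := N) (e := e) (t := tv (r e)) _).
          by rewrite ceq_rs ceq_ss.
        exact: (@gs_path N (r e) [::]).
      by apply: zero; rewrite -ceq_ss -ceq_mulA ceq_vw // ceq_mul0.
    case: (classic (e = d)) => [->|Hed].
      apply: gs_ceq (gs_path _ Hp).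
      by rewrite ceq_mulA ceq_ee Hr vertex_mul_path.
    by apply: zero; rewrite ceq_mulA ceq_ef // ceq_0mul.
- move=> N e t _ IH; apply: gs_ceq (gs_ghost IH); by rewrite ceq_mulA.
Qed.

Lemma mul_ghost_span t N v u :
  ghost_span N v u -> exists M, ghost_span M v (tmul t u).
Proof.
elim: t N u => [g||a IHa b IHb|k a IHa|a IHa b IHb] N u Hu.
- by exists N.+1; apply: gen_mul_ghost_span.
- by exists N; apply: gs_ceq (gs_zero N v); rewrite ceq_0mul.
- have [Ma Ha] := IHa N u Hu; have [Mb Hb] := IHb N u Hu.
  exists (maxn Ma Mb).
  apply: (gs_ceq (t := tadd (tmul a u) (tmul b u))); first by rewrite ceq_mulDl.
  by apply: gs_add; [apply: ghost_span_le Ha | apply: ghost_span_le Hb];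
    rewrite ?leq_maxl ?leq_maxr.
- have [M Ha] := IHa N u Hu; exists M.
  by apply: gs_ceq (gs_scal k Ha); rewrite ceq_scal_mull.
- have [M Hb] := IHb N u Hu; have [M' Ha] := IHa M _ Hb; exists M'.
  by apply: gs_ceq Ha; rewrite ceq_mulA.
Qed.

Lemma mul_vertex_ghost_span t v : exists N, ghost_span N v (tmul t (tv v)).
Proof. exact: (@mul_ghost_span t 0%N v (path_term v [::]) (@gs_path _ _ _ _)). Qed.

(** * Local units *)

Lemma tsum_mul0 (A : Type) (g : A -> T) l t :
  (forall a, List.In a l -> tmul t (g a) =~ tzero) ->
  tmul t (tsum (map g l)) =~ tzero.
Proof.
elim: l => [|a l IHl] H /=; first exact: ceq_mul0.
rewrite ceq_mulDr H; last by left.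
by rewrite IHl ?ceq_add0 // => b Hb; apply: H; right.
Qed.

Lemma mul_tsum_one (A : Type) (g : A -> T) l t a : List.NoDup l -> List.In a l ->
  tmul t (g a) =~ t ->
  (forall b, b <> a -> tmul t (g b) =~ tzero) -> tmul t (tsum (map g l)) =~ t.
Proof.
move=> Hl Ha H1 H0; elim: Hl Ha => [//|b l' Hb _ IHl] /= [Hab|Ha].
  rewrite ceq_mulDr {1}Hab H1 tsum_mul0 ?ceq_add0 // => c Hc; apply: H0 => Eca.
  by apply: Hb; rewrite Hab -Eca.
rewrite ceq_mulDr IHl // H0 ?ceq_0add // => Eba; apply: Hb; by rewrite Eba.
Qed.

(** The vertex set may be infinite, so only finite sums of vertices can act as units. Allowing every
    larger list [L'] lets the lists of two summands be merged. *)
Lemma local_unit t : exists L : list V, forall L', List.NoDup L' ->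
  (forall v, List.In v L -> List.In v L') ->
  tmul t (tsum [seq tv v | v <- L']) =~ t.
Proof.
have gen g v : tmul (tgen g) (tv v) =~ tgen g -> exists L : list V, forall L',
    List.NoDup L' -> (forall v, List.In v L -> List.In v L') ->
    tmul (tgen g) (tsum [seq tv v | v <- L']) =~ tgen g.
  move=> E; exists [:: v] => L' HL' Hsub.
  apply: (mul_tsum_one (a := v)) => //; first by apply: Hsub; left.
  by move=> w Hw; rewrite -E -ceq_mulA ceq_vw ?ceq_mul0 // => /esym.
elim: t => [[v|e|e]||a [La IHa] b [Lb IHb]|k a [La IHa]|a _ b [Lb IHb]].
- by apply: (gen _ v); apply: ceq_vv.
- by apply: (gen _ (r e)); apply: ceq_er.
- by apply: (gen _ (s e)); apply: ceq_ss.
- by exists [::] => L' _ _; apply: ceq_0mul.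
- exists (La ++ Lb) => L' HL' Hsub; rewrite ceq_mulDl IHa ?IHb // => v Hv;
    by apply: Hsub; apply: List.in_or_app; auto.
- by exists La => L' HL' Hsub; rewrite -ceq_scal_mull IHa.
- by exists Lb => L' HL' Hsub; rewrite -ceq_mulA IHb.
Qed.

Lemma exists_NoDup (A : Type) (l : list A) :
  exists l', List.NoDup l' /\ (forall a, List.In a l' <-> List.In a l).
Proof.
pose dec (a b : A) := excluded_middle_informative (a = b).
exists (List.nodup dec l); split; first exact: List.NoDup_nodup.
by move=> a; apply: List.nodup_In.
Qed.

Lemma ceq0_of_vertices t : (forall v, tmul t (tv v) =~ tzero) -> t =~ tzero.
Proof.
move=> H; have [L HL] := local_unit t; have [L' [HL' Hsub]] := exists_NoDup L.
rewrite -(HL L') // => [|v Hv]; last by apply/Hsub.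
by apply: tsum_mul0 => v _.
Qed.

(** * Cutting off finitely many edges at a vertex *)

Definition range_sum (F : list Ed) : T := tsum [seq tmul (te e) (ts e) | e <- F].

(** For distinct edges leaving [v] this is an idempotent, which [pi] sends to the restriction to the
    part of $D_v$ outside the $R_e$, [e] in [F]. *)
Definition gap (v : V) (F : list Ed) : T :=
  tadd (tv v) (tscal (-1) (range_sum F)).

Lemma mul_gap t v F : tmul t (tv v) =~ t ->
  (forall e, List.In e F -> tmul t (te e) =~ tzero) -> tmul t (gap v F) =~ t.
Proof.
move=> Ht HF; rewrite /gap ceq_mulDr Ht -ceq_scal_mulr tsum_mul0.
  by rewrite ceq_scal0 ceq_add0.
by move=> e He; rewrite ceq_mulA HF // ceq_0mul.
Qed.

Lemma ghost_mul_gap e F : List.NoDup F -> List.In e F ->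
  tmul (ts e) (gap (s e) F) =~ tzero.
Proof.
move=> HF He; rewrite /gap ceq_mulDr ceq_ss -ceq_scal_mulr.
rewrite (mul_tsum_one (a := e)) //; first exact: ceq_addN.
  by rewrite ceq_mulA ceq_ee ceq_rs.
by move=> d Hd; rewrite ceq_mulA ceq_ef ?ceq_0mul // => /esym.
Qed.

Definition path_comb (v : V) (l : list (K * list Ed)) : T :=
  foldr (fun kp t => tadd (tscal kp.1 (path_term v kp.2)) t) tzero l.

Definition paths_to (v : V) (l : list (K * list Ed)) : Prop :=
  forall kp, List.In kp l -> path kp.2 v.

Lemma path_comb_cat v l l' :
  path_comb v (l ++ l') =~ tadd (path_comb v l) (path_comb v l').
Proof.
by elim: l => [|kp l IHl] /=; [rewrite ceq_0add | rewrite IHl ceq_addA].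
Qed.

Lemma path_comb_scal v k l :
  path_comb v [seq (k * kp.1, kp.2) | kp <- l] =~ tscal k (path_comb v l).
Proof.
elim: l => [|kp l IHl] /=; first by rewrite ceq_scal0.
by rewrite IHl ceq_scalDr ceq_scalA.
Qed.

Lemma paths_to_cat v l l' : paths_to v l -> paths_to v l' -> paths_to v (l ++ l').
Proof. by move=> H H' kp /(List.in_app_or _ _ _) [/H|/H']. Qed.

Lemma paths_to_scal v (k : K) l :
  paths_to v l -> paths_to v [seq (k * kp.1, kp.2) | kp <- l].
Proof.
move=> H kp; elim: l H => [//|kp' l IHl] H /= [<-|Hin].
  by apply: (H kp'); left.
by apply: IHl => // kp'' Hk; apply: H; right.
Qed.

Lemma ghost_span0_comb v t : ghost_span 0 v t ->
  exists l, paths_to v l /\ t =~ path_comb v l.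
Proof.
move EN : 0%N => N H; elim: H EN => {N v t} //.
- by move=> N v t u E _ IH /IH [l [Hl El]]; exists l; rewrite -E.
- by move=> N v _; exists [::]; split=> // kp [].
- move=> N v t u _ IHt _ IHu EN.
  have [l [Hl El]] := IHt EN; have [l' [Hl' El']] := IHu EN.
  exists (l ++ l'); split; first exact: paths_to_cat.
  by rewrite path_comb_cat El El'.
- move=> N v k t _ IH /IH [l [Hl El]].
  exists [seq (k * kp.1, kp.2) | kp <- l]; split; first exact: paths_to_scal.
  by rewrite path_comb_scal El.
- move=> N v p Hp _; exists [:: (1, p)]; split; first by move=> kp [<-|].
  by rewrite /= ceq_scal1 ceq_add0.
Qed.

(** If $\beta$ is nontrivial, $\alpha\beta^*$ ends in the ghost of an edge at [v], and the gap kills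
    it once [F] contains that edge. [F0] collects these edges; only real paths remain. *)
Lemma ghost_span_mul_gap N v t : ghost_span N v t ->
  exists l F0, [/\ paths_to v l, (forall e, List.In e F0 -> s e = v) &
    forall F, List.NoDup F -> (forall e, List.In e F0 -> List.In e F) ->
      tmul t (gap v F) =~ tmul (path_comb v l) (gap v F)].
Proof.
elim=> {N v t}.
- move=> N v t u E _ [l [F0 [Hl HF0 H]]]; exists l, F0; split=> // F HF Hsub.
  by rewrite -E; apply: H.
- by move=> N v; exists [::], [::]; split=> // kp [].
- move=> N v t u _ [l [F0 [Hl HF0 H]]] _ [l' [F0' [Hl' HF0' H']]].
  exists (l ++ l'), (F0 ++ F0'); split; first exact: paths_to_cat.
    by move=> e /(List.in_app_or _ _ _) [/HF0|/HF0'].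
  move=> F HF Hsub; rewrite path_comb_cat !ceq_mulDl H ?H' // => e He;
    by apply: Hsub; apply: List.in_or_app; auto.
- move=> N v k t _ [l [F0 [Hl HF0 H]]].
  exists [seq (k * kp.1, kp.2) | kp <- l], F0; split=> //.
    exact: paths_to_scal.
  by move=> F HF Hsub; rewrite path_comb_scal -!ceq_scal_mull H.
- move=> N v p Hp; exists [:: (1, p)], [::]; split=> //.
    by move=> kp [<-|].
  by move=> F _ _; rewrite /= ceq_scal1 ceq_add0.
- move=> N e t _ _; exists [::], [:: e]; split=> //.
    by move=> d [->|].
  move=> F HF Hsub; rewrite /= ceq_0mul -ceq_mulA ghost_mul_gap ?ceq_mul0 //.
  by apply: Hsub; left.
Qed.

(** Coefficients of equal paths are collected, so that each can later be read off at a single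
    point. *)
Lemma path_comb_NoDup v l : exists l', [/\ List.NoDup (map snd l'),
  (forall p, List.In p (map snd l') -> List.In p (map snd l)) &
  path_comb v l =~ path_comb v l'].
Proof.
elim: l => [|[k p] l [l' [Hnd Hsub El]]].
  by exists [::]; split=> //; constructor.
case: (classic (List.In p (map snd l'))) => [Hp|Hp]; last first.
  exists ((k, p) :: l'); split; first by constructor.
    by move=> q /= [->|/Hsub]; auto.
  by rewrite /= El.
suff [l'' [Es El']] : exists l'', map snd l'' = map snd l' /\
    path_comb v l'' =~ tadd (tscal k (path_term v p)) (path_comb v l').
  exists l''; rewrite Es; split=> //; first by move=> q /Hsub; right.
  by rewrite /= El' El.
elim: l' Hp {Hnd Hsub El} => [//|[k' p'] l' IHl] /= [Ep|Hp].
  exists ((k + k', p') :: l'); split=> //=.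
  by rewrite Ep ceq_scalDl ceq_addA.
have [l'' [Es El]] := IHl Hp; exists ((k', p') :: l''); split.
  by rewrite /= Es.
by rewrite /= El !ceq_addA [tadd (tscal k' _) _]ceq_addC.
Qed.

End Algebra.

(** * Sufficiency *)

Section Sufficiency.
Variables (K : fieldType) (V Ed : Type) (s r : Ed -> V) (X : V -> Prop).
Variables (Xs : Type) (R : Ed -> Xs -> Prop) (D : V -> Xs -> Prop)
          (f : Ed -> Xs -> Xs).
Hypothesis HB : branching_system s r X R D f.

Local Notation T := (term K V Ed).
Local Notation tv v := (@tgen K V Ed (GV Ed v)).
Local Notation te e := (@tgen K V Ed (@GE V Ed e)).
Local Notation pi := (@Defs.pi K V Ed r Xs R D f).
Local Notation fc := (fc_map f).
Local Notation path := (path_to s r).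
Local Notation start := (start s).
Local Notation closed := (closed_path s r).
Local Notation delta := (@delta K Xs).
Local Notation path_comb := (@path_comb K V Ed).
Local Notation "t =~ u" := (@ceq K V Ed s r X t u) (at level 70).

Definition separates (z : Xs) (l : list (K * list Ed)) : Prop :=
  forall p q, List.In p (map snd l) -> List.In q (map snd l) ->
    fc p z = fc q z -> p = q.

(** Distinct paths send the point mass at [z] to distinct points, so the value at [fc p z] is the
    coefficient of [p] alone. *)
Lemma path_comb_eq0 v l z : paths_to s r v l -> D v z -> separates z l ->
  (forall y, pi (path_comb v l) (delta z) y = 0) -> path_comb v l =~ tzero.
Proof.
move=> Hl Dz Hsep Hpi; have [l' [Hnd Hsub El]] := path_comb_NoDup s r X v l.
rewrite (pi_sound HB El) in Hpi; apply: ceq_trans El _.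
have {}Hl p : List.In p (map snd l') -> path p v.
  by move=> /Hsub /(proj1 (List.in_map_iff _ _ _)) [kp [<- /Hl]].
have {}Hsep p q : List.In p (map snd l') -> List.In q (map snd l') ->
    fc p z = fc q z -> p = q.
  by move=> /Hsub Hp /Hsub Hq; apply: Hsep.
elim: l' Hnd Hl Hsep Hpi {Hsub} => [|[k p] l' IHl] Hnd Hl Hsep Hpi /=.
  exact: ceq_refl.
move/List.NoDup_cons_iff: Hnd => [/= Hp Hnd].
have Hpath : path p v by apply: Hl; left.
have out q : List.In q (map snd l') -> fc p z <> fc q z.
  move=> Hq /Hsep E; apply: Hp; rewrite E //; [by left | by right].
have Hrest : pi (path_comb v l') (delta z) (fc p z) = 0.
  have Hl' q : List.In q (map snd l') -> path q v by move=> Hq; apply: Hl; right.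
  elim: (l') out Hl' => [//|[k' q] l'' IH] out Hl' /=.
  rewrite IH ?addr0 => [|q' Hq'|q' Hq']; last by apply: Hl'; right.
    rewrite (pi_path_delta_neq _ HB) ?mulr0 //; first by apply: Hl'; left.
    by apply: out; left.
  by apply: out; right.
have k0 : k = 0.
  have := Hpi (fc p z); rewrite /= Hrest addr0 (pi_path_in HB) //.
  by rewrite delta_eq mulr1.
rewrite k0; apply: (ceq_trans (ceq_add (ceq_0scal _ _ _ _) (IHl _ _ _ _))) => //.
- by move=> q Hq; apply: Hl; right.
- by move=> q q' Hq Hq'; apply: Hsep; right.
- by move=> y; have := Hpi y; rewrite /= k0 mul0r add0r.
- exact: ceq_add0.
Qed.

(** Two paths with the same image of [z] differ by a suffix [g] fixing [z]; a nonempty [g] would be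
    a closed path at [v] of length at most [B]. *)
Lemma aperiodic_separates B v z l : paths_to s r v l -> D v z ->
  (forall p, List.In p (map snd l) -> (size p <= B)%N) ->
  (forall g, closed v g -> (size g <= B)%N -> fc g z <> z) -> separates z l.
Proof.
move=> Hl Dz HB' Hz.
have path_of p : List.In p (map snd l) -> path p v.
  by move=> /(proj1 (List.in_map_iff _ _ _)) [kp [<- /Hl]].
have ext p q g : List.In p (map snd l) -> p = q ++ g -> z = fc g z -> p = q.
  move=> Hp Ep Ez; case: (classic (g = [::])) => [Eg|Hg].
    by rewrite Ep Eg cats0.
  have Hgp : path g v by move: (path_of p Hp); rewrite Ep => /path_to_cat [].
  case: (Hz g) => //; last first.
    by apply: leq_trans (HB' p Hp); rewrite Ep size_cat leq_addl.
  split=> //; have := fc_in_D HB Hgp Dz; rewrite -Ez => Dz'.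
  exact: (D_disjoint HB Dz' Dz).
move=> p q Hp Hq; case/(fc_compare HB (path_of p Hp) (path_of q Hq) Dz Dz).
  by case=> g [Ep Ez]; apply: ext Ep Ez.
by case=> g [Eq Ez]; symmetry; apply: ext Eq Ez.
Qed.

Lemma size_bound (l : list (K * list Ed)) :
  exists B, forall p, List.In p (map snd l) -> (size p <= B)%N.
Proof.
elim: l => [|kp l [B HBd]]; first by exists 0%N.
exists (maxn (size kp.2) B) => p /= [<-|/HBd Hp]; first exact: leq_maxl.
exact: leq_trans Hp (leq_maxr _ _).
Qed.

Lemma pi_gap_delta v F z : List.NoDup F -> D v z ->
  (forall e, List.In e F -> ~ R e z) -> pi (gap K v F) (delta z) = delta z.
Proof.
move=> HF Dz Hz; apply: functional_extensionality => x.
rewrite -[LHS]/(pi (tv v) (delta z) x + -1 * pi (range_sum K V F) (delta z) x).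
case: (classic (x = z)) => [->|Hxz].
  by rewrite pi_V_in // pi_range_sum_out // mulr0 addr0.
have -> : pi (range_sum K V F) (delta z) x = 0.
  case: (classic (exists e, List.In e F /\ R e x)) => [[e [He Re]]|Hno].
    by rewrite (pi_range_sum_in HB _ HF He Re) delta_neq.
  by apply: pi_range_sum_out => e He Re; apply: Hno; exists e.
rewrite mulr0 addr0; case: (classic (D v x)) => Dx; first by rewrite pi_V_in.
by rewrite pi_V_out // delta_neq.
Qed.

Hypothesis HX : forall v, X v -> regular s v.
Hypothesis D_nonempty : forall v, exists x, D v x.
Hypothesis not_covered : forall v, regular s v /\ ~ X v ->
  ~ (forall x, D v x <-> exists e, s e = v /\ R e x).
Hypothesis cycle_aperiodic : forall (c : list Ed) (e1 : Ed) (rest : list Ed),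
  c = e1 :: rest -> is_cycle s r c -> no_exit s c ->
  (forall d, List.In d c -> ~ (regular s (s d) /\ ~ X (s d))) ->
  forall m : nat, exists z0, D (s e1) z0 /\
    (forall j : nat, (1 <= j <= m)%N -> iter j (fc c) z0 <> z0).

Lemma exists_separating v l : paths_to s r v l -> exists z, D v z /\ separates z l.
Proof.
move=> Hl; have [B HBd] := size_bound l.
have [z [Dz Hz]] := exists_aperiodic HB D_nonempty not_covered cycle_aperiodic B v.
by exists z; split=> //; apply: aperiodic_separates Hz.
Qed.

(** If an edge [e] at [v] is missing from [F], take $f_e(z)$ with [z] separating the paths prolonged
    by [e]. Otherwise [F] is $s^{-1}(v)$: it is empty, or [v] is in $Y$ and (2) gives a point
    outside all $R_e$, which no closed path fixes. *)
Lemma exists_separating_outside v l F : ~ X v -> paths_to s r v l ->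
  List.NoDup F -> (forall e, List.In e F -> s e = v) ->
  exists z, [/\ D v z, separates z l & forall e, List.In e F -> ~ R e z].
Proof.
move=> nX Hl HF HFs.
case: (classic (exists e, s e = v /\ ~ List.In e F)) => [[e [He HeF]]|Hall].
  pose l' := [seq (kp.1, kp.2 ++ [:: e]) | kp <- l].
  have Hl' : paths_to s r (r e) l'.
    move=> kp /(proj1 (List.in_map_iff _ _ _)) [kp' [<- Hk]].
    by apply/path_to_cat; rewrite /= He; split=> //; apply: Hl.
  have in_l' p : List.In p (map snd l) -> List.In (p ++ [:: e]) (map snd l').
    rewrite /l'; elim: (l) => [//|kp l0 IH] /= [<-|Hp]; first by left.
    by right; apply: IH.
  have [z [Dz Hz]] := exists_separating Hl'.
  exists (f e z); split.
  - by rewrite -He; apply: (R_sub_D HB); apply: (f_in_R HB).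
  - move=> p q /in_l' Hp /in_l' Hq Epq.
    have := Hz _ _ Hp Hq; rewrite !fc_cat => /(_ Epq).
    by rewrite !cats1 => /rcons_inj [].
  - move=> d Hd Rd; apply: HeF.
    by rewrite -(R_disjoint HB Rd (f_in_R HB Dz)).
have Fall e : List.In e F <-> s e = v.
  split; first exact: HFs.
  by move=> He; apply: NNPP => HeF; apply: Hall; exists e.
case: F HF HFs Fall {Hall} => [|e0 F] HF HFs Fall.
  by have [z [Dz Hz]] := exists_separating Hl; exists z.
have Y : regular s v /\ ~ X v by split=> //; exists (e0 :: F).
have [z [Dz Hz]] : exists z, D v z /\ forall e, s e = v -> ~ R e z.
  apply: NNPP => Hno; apply: (not_covered Y) => x; split.
    move=> Dx; apply: NNPP => Hx; apply: Hno; exists x; split=> // e He Re.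
    by apply: Hx; exists e.
  by case=> e [<- Re]; apply: (R_sub_D HB Re).
have [B HBd] := size_bound l.
exists z; split=> //; last by move=> e /Fall; apply: Hz.
apply: (aperiodic_separates Hl Dz HBd) => g [Hg Hgs Hg0] _ Ez.
case: g Hg Hgs Hg0 Ez => [//|e g] Hg /= Hgs _ Ez.
by apply: (Hz e Hgs); rewrite -Ez; apply: (fc_in_R HB Hg Dz).
Qed.

Lemma ghost_span_injective N v t : ghost_span s r X N v t ->
  (forall phi x, pi t phi x = 0) -> t =~ tzero.
Proof.
elim: N v t => [|N IHN] v t Ht Hpi.
  have [l [Hl El]] := ghost_span0_comb Ht.
  have [z [Dz Hz]] := exists_separating Hl.
  apply: (ceq_trans El); apply: (path_comb_eq0 Hl Dz Hz) => y.
  by rewrite -(pi_sound HB El).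
have [l [F0 [Hl HF0 HF]]] := ghost_span_mul_gap Ht.
have mul_edge e : s e = v -> tmul t (te e) =~ tzero.
  move=> He; apply: (IHN (r e)); last by move=> phi x; apply: Hpi.
  by apply: ghost_span_mul_edge; rewrite He.
have Htv := ghost_span_mulr Ht.
case: (classic (X v)) => HXv.
  have [F [HFnd [_ HFs]]] := HX HXv.
  apply: ceq_trans (ceq_sym Htv) _.
  apply: ceq_trans (ceq_mul (ceq_refl _ _ _ _) (ceq_CK _ _ HXv HFnd HFs)) _.
  apply: tsum_mul0 => e /HFs /mul_edge Ee.
  apply: ceq_trans (ceq_mulA _ _ _ _ _ _) _.
  exact: ceq_trans (ceq_mul Ee (ceq_refl _ _ _ _)) (ceq_0mul _ _ _ _).
have [F [HFnd HFF0]] := exists_NoDup F0.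
have HFs e : List.In e F -> s e = v by move=> /HFF0; apply: HF0.
(* All [t e] vanish, so [t] is unchanged by the gap, while the gap removes the ghost terms of
   [t]. *)
have Et : t =~ tmul (path_comb v l) (gap K v F).
  apply: ceq_trans (HF F HFnd _); last by move=> e /HFF0.
  by apply: ceq_sym; apply: mul_gap => // e /HFs; apply: mul_edge.
have [z [Dz Hz Rz]] := exists_separating_outside HXv Hl HFnd HFs.
have E0 : path_comb v l =~ tzero.
  apply: (path_comb_eq0 Hl Dz Hz) => y; rewrite -(pi_gap_delta HFnd Dz Rz).
  by have := Hpi (delta z) y; rewrite (pi_sound HB Et).
apply: ceq_trans Et (ceq_trans (ceq_mul E0 (ceq_refl _ _ _ _)) (ceq_0mul _ _ _ _)).
Qed.

Lemma pi_injective_sufficient : pi_injective K s r X R D f.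
Proof.
move=> t u Htu; apply: ceq_sub_eq0; apply: ceq0_of_vertices => v.
have [N HN] := mul_vertex_ghost_span s r X (tadd t (tscal (-1) u)) v.
apply: ghost_span_injective HN _ => phi x.
by rewrite /= Htu mulN1r subrr.
Qed.

End Sufficiency.

(** * The boundary path model *)

Section BoundaryPaths.
Variables (V Ed : Type) (s r : Ed -> V) (X : V -> Prop).

(* A point is a path with its source vertex and an integer counter. The path
   [sigma] takes the value [None] forever once it has stopped, which may only
   happen outside [X]; the counter makes every nontrivial [fc_map] free. *)
Definition bpoint : Type := (V * (nat -> option Ed) * int)%type.

Definition bpath (v : V) (sigma : nat -> option Ed) : Prop :=
  (if sigma 0%N is Some e then s e = v else ~ X v) /\
  forall n, match sigma n, sigma n.+1 with
            | Some e, Some d => r e = s d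
            | Some e, None => ~ X (r e)
            | None, Some _ => False
            | None, None => True
            end.

Definition bD (v : V) (x : bpoint) : Prop := x.1.1 = v /\ bpath v x.1.2.

Definition bR (e : Ed) (x : bpoint) : Prop := x.1.2 0%N = Some e /\ bD (s e) x.

Definition bf (e : Ed) (x : bpoint) : bpoint :=
  (s e, fun n => if n is m.+1 then x.1.2 m else Some e, x.2 + 1).

Lemma boundary_branching : branching_system s r X bR bD bf.
Proof.
split.
- by move=> d e Hde x [[H _] [H' _]]; apply: Hde; move: H; rewrite H' => -[].
- by move=> u v Huv x [[H _] [H' _]]; apply: Huv; rewrite -H -H'.
- by move=> e x [].
- move=> v Xv x; split; last by case=> e [<-] [].
  case=> Hv [H0 H1]; case E0 : (x.1.2 0%N) H0 => [e|] // He.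
  by exists e; split=> //; rewrite /bR /bD He /bpath E0.
- move=> e; split; last split.
  + move=> [[u sigma] n] [/= Hu [H0 H1]]; split=> //; split=> //.
    split=> // -[|m]; last exact: H1.
    by move=> /=; case: (sigma 0%N) H0 => [d /esym|].
  + move=> [[u sigma] n] [[u' sigma'] n'] [/= -> _] [/= -> _] [H /addIr ->].
    congr (_, _, _); apply: functional_extensionality => m.
    by have := f_equal (fun g : nat -> option Ed => g m.+1) H.
  + move=> [[u sigma] n] [/= E0 [/= Hu [_ H1]]].
    exists (r e, fun m => sigma m.+1, n - 1); split.
      split=> //=; split; last by move=> m; apply: H1.
      by move: (H1 0%N); rewrite E0; case: (sigma 1%N).
    rewrite /bf /= subrK Hu; congr (_, _, _).
    by apply: functional_extensionality => -[|m].
Qed.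

(** Fix an outgoing edge at each vertex of $X$, follow these edges from [v], and stop on leaving
    $X$. *)
Lemma boundary_nonempty (HX : forall v, X v -> regular s v) v : exists x, bD v x.
Proof.
have [next Hnext] : exists next : V -> option Ed,
    forall w, if next w is Some e then s e = w else ~ X w.
  apply: (ClassicalEpsilon.choice
    (fun w o => if o is Some e then s e = w else ~ X w)) => w.
  case: (classic (X w)) => [Xw|nXw]; last by exists None.
  have [[|e l] [_ [Hl He]]] := HX w Xw => //.
  by exists (Some e); apply/He; left.
pose vtx := fix vtx n :=
  if n is m.+1 then obind (omap r \o next) (vtx m) else Some v.
exists (v, fun n => obind next (vtx n), 0); split=> //=; split; first exact: Hnext.
move=> n /=; case: (vtx n) => [w|] //=.
by case: (next w) => [e|] //=; have := Hnext (r e); case: (next (r e)).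
Qed.

Lemma boundary_stopped v : ~ X v -> bD v (v, fun=> None, 0).
Proof. by []. Qed.

Lemma boundary_counter p x : (fc_map bf p x).2 = x.2 + (size p)%:R.
Proof.
elim: p => [|e p IHp] /=; first by rewrite addr0.
by rewrite IHp -addrA -natr1.
Qed.

End BoundaryPaths.

(** * Necessity *)

Section Necessity.
Variables (K : fieldType) (V Ed : Type) (s r : Ed -> V) (X : V -> Prop).
Hypothesis HX : forall v, X v -> regular s v.

Local Notation tv v := (@tgen K V Ed (GV Ed v)).
Local Notation ceq := (@ceq K V Ed s r X).

Lemma vertex_neq0 v : ~ ceq (tv v) tzero.
Proof.
move=> /(pi_sound (boundary_branching s r X)) E.
have [x Dx] := boundary_nonempty r HX v.
have := f_equal (fun g => g (fun=> 1) x) E.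
by rewrite pi_V_in // => /eqP; rewrite oner_eq0.
Qed.

(** For [v] outside $X$ the path that stops at once lies in $D_v$ but in no $R_e$. *)
Lemma vertex_neq_range_sum v l : ~ X v -> ~ ceq (tv v) (range_sum K V l).
Proof.
move=> nX /(pi_sound (boundary_branching s r X)) E.
have := f_equal (fun g => g (fun=> 1) (v, fun=> None, 0)) E.
rewrite pi_V_in; last exact: boundary_stopped.
by rewrite pi_range_sum_out => [/eqP|e _ []//]; rewrite oner_eq0.
Qed.

Lemma path_neq_vertex p v : path_to s r p v -> p <> [::] ->
  ~ ceq (path_term K v p) (tv v).
Proof.
move=> Hp Hp0 /(pi_sound (boundary_branching s r X)) E.
have [x Dx] := boundary_nonempty r HX v.
have := f_equal (fun g => g (delta K x) (fc_map (bf s) p x)) E.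
(* The counter has grown by the length of [p], which is nonzero as an integer whatever the
   characteristic of [K]. *)
have Hx : fc_map (bf s) p x <> x.
  move=> /(f_equal snd); rewrite boundary_counter => /eqP.
  rewrite -subr_eq0 addrC addKr; case: p Hp0 {Hp E} => // e p _.
  by rewrite Num.Theory.pnatr_eq0.
rewrite (pi_path_in (boundary_branching s r X)) // delta_eq.
case: (classic (bD s r X v (fc_map (bf s) p x))) => H.
  by rewrite pi_V_in // delta_neq // => /eqP; rewrite oner_eq0.
by rewrite pi_V_out // => /eqP; rewrite oner_eq0.
Qed.

Variables (Xs : Type) (R : Ed -> Xs -> Prop) (D : V -> Xs -> Prop)
          (f : Ed -> Xs -> Xs).
Hypothesis HB : branching_system s r X R D f.
Hypothesis Hinj : pi_injective K s r X R D f.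

Lemma injective_D_nonempty v : exists x, D v x.
Proof.
apply: NNPP => Hno; apply: (@vertex_neq0 v); apply: Hinj => phi x.
by rewrite pi_V_out // => Dx; apply: Hno; exists x.
Qed.

Lemma injective_not_covered v : regular s v /\ ~ X v ->
  ~ (forall x, D v x <-> exists e, s e = v /\ R e x).
Proof.
case=> [[l [Hl [_ Hls]]] nX] Hcov; apply: (@vertex_neq_range_sum v l nX).
apply: Hinj => phi x; case: (classic (D v x)) => Dx.
  have [e [He Re]] := (Hcov x).1 Dx.
  by rewrite pi_V_in // (pi_range_sum_in HB _ Hl ((Hls e).2 He) Re).
rewrite pi_V_out // pi_range_sum_out // => e He Re; apply: Dx; apply/Hcov.
by exists e; split=> //; apply/Hls.
Qed.

(* If all points of D_v had periods at most m, then c^(m!) would act like v. *)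
Lemma injective_aperiodic v c m : closed_path s r v c ->
  exists z, D v z /\ forall j, (1 <= j <= m)%N -> iter j (fc_map f c) z <> z.
Proof.
move=> [Hc Hcs Hc0]; apply: NNPP => Hno.
have Hfix z : D v z -> fc_map f (power m`! c) z = z.
  move=> Dz;
  have [j [Hj Ez]] : exists j, (1 <= j <= m)%N /\ iter j (fc_map f c) z = z.
    apply: NNPP => Hz; apply: Hno; exists z; split=> // j Hj Ez.
    by apply: Hz; exists j.
  (* The period $j \le m$ of [z] divides $m!$. *)
  rewrite fc_power -(divnK (dvdn_fact Hj)); elim: (_ %/ _)%N => [//|k IHk].
  by rewrite mulSn iterD IHk.
have [Hp Hps] := power_path m`! Hc Hcs.
apply: (path_neq_vertex Hp).
  move/(congr1 size)/eqP; rewrite size_power muln_eq0 -leqn0 leqNgt fact_gt0 /=.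
  by case: (c) Hc0.
apply: Hinj => phi x; case: (classic (D v x)) => Dx.
  by rewrite pi_V_in // -{1}(Hfix x Dx) (pi_path_in HB).
rewrite pi_V_out // (pi_path_out HB) // => y Dy Exy.
by apply: Dx; rewrite Exy Hfix.
Qed.

End Necessity.

Theorem mainTheorem11 (K : fieldType) (V Ed : Type) (s r : Ed -> V)
  (X : V -> Prop) (HX : forall v, X v -> regular s v)
  (Xs : Type) (R : Ed -> Xs -> Prop) (D : V -> Xs -> Prop)
  (f : Ed -> Xs -> Xs)
  (HB : branching_system s r X R D f) :
  let Y := fun v => regular s v /\ ~ X v in
  pi_injective K s r X R D f <->
  [/\ (forall e, exists x, R e x) /\ (forall v, exists x, D v x),
      (forall v, Y v -> ~ (forall x, D v x <-> exists e, s e = v /\ R e x)) &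
      (forall (c : list Ed) (e1 : Ed) (rest : list Ed), c = e1 :: rest ->
         is_cycle s r c -> no_exit s c ->
         (forall d, List.In d c -> ~ Y (s d)) ->
         forall m : nat, exists z0, D (s e1) z0 /\
           (forall j : nat, (1 <= j <= m)%N ->
              iter j (fc_map f c) z0 <> z0))].
Proof.
move=> Y; split=> [Hinj|[[_ HD] HY Hcyc]]; last exact: pi_injective_sufficient.
have HD := injective_D_nonempty HX Hinj.
split; [split=> // e | exact: injective_not_covered HB Hinj |].
  (* $R_e$ contains the image under $f_e$ of a point of $D_{r(e)}$. *)
  by have [x Dx] := HD (r e); exists (f e x); apply: (f_in_R HB).
move=> c e1 rest -> Hc _ _ m.
exact: (injective_aperiodic HX HB Hinj m (is_cycle_path Hc)).
Qed.
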